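(* The finite projective plane $\Psi$ of order $9$ (the Hughes plane of order $9$) is not a Poncelet plane.
   Context: $\Psi$ denotes the Hughes plane of order $9$, the self-dual non-Desarguesian projective plane of order $9$ constructed over the miniquaternion near-field; up to isomorphism it is the unique self-dual projective plane of order $9$ not isomorphic to $PG(2,9)$. An oval in a plane of order $n$ is a set of $n+1$ points no three collinear; secants/tangents of an oval are lines meeting it in two/exactly one point. For an ordered pair of ovals $(O_t,O_s)$, an $m$-sided Poncelet polygon ($3\le m\le n+1$) is a cyclically ordered $m$-tuple of distinct points of $O_s$ with every line joining cyclically consecutive vertices a tangent of $O_t$. $(O_t,O_s)$ is a Poncelet $m$-pair if an $m$-sided Poncelet polygon exists but no $m'$-sided one for $m'\neq m$, $3\le m'\le n+1$; a Poncelet $0$-pair if no secant of $O_s$ is a tangent of $O_t$; a Poncelet $\infty$-pair if some secant of $O_s$ is tangent to $O_t$ but no Poncelet polygon exists. A Poncelet plane is one in which every pair of ovals is a Poncelet $m$-pair ($3\le m\le n+1$), a Poncelet $0$-pair or a Poncelet $\infty$-pair. *)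

(* Defs.v *)
From mathcomp Require Import all_boot all_order all_algebra.
Set Implicit Arguments.
Unset Strict Implicit.
Unset Printing Implicit Defensive.

Import GRing.Theory.
Local Open Scope ring_scope.

Record projPlane (n : nat) := ProjPlane {
  point : finType;
  line : finType;
  inc : point -> line -> bool;
  join_ex1 : forall p q, p != q -> exists! l, inc p l && inc q l;
  meet_ex1 : forall l k, l != k -> exists! p, inc p l && inc p k;
  quadrangle : exists2 Q : {set point},
    #|Q| = 4%N & forall l, (#|[set p in Q | inc p l]| <= 2)%N;
  line_card : forall l, #|[set p | inc p l]| = n.+1
}.

Section Poncelet.
Variables (n : nat) (Pi : projPlane n).
Implicit Types (p q r : point Pi) (l : line Pi) (O Ot Os : {set point Pi}).

Definition collinear p q r := [exists l : line Pi, [&& inc p l, inc q l & inc r l]].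

Definition oval O : Prop :=
  #|O| = n.+1 /\
  forall p q r, p \in O -> q \in O -> r \in O ->
    p != q -> p != r -> q != r -> ~~ collinear p q r.

Definition secant O l := #|[set p in O | inc p l]| == 2%N.
Definition tangent O l := #|[set p in O | inc p l]| == 1%N.

(* Only ever applied to distinct points, for which [l] is the joining line. *)
Definition tangent_join Ot p q :=
  [exists l : line Pi, [&& inc p l, inc q l & tangent Ot l]].

(* [cycle] also imposes the condition on the last and first vertices. *)
Definition poncelet_polygon Ot Os (m : nat) (t : m.-tuple (point Pi)) : Prop :=
  [/\ uniq t, {subset t <= Os} & cycle (tangent_join Ot) t].

Definition has_poncelet_polygon Ot Os (m : nat) : Prop :=
  exists t : m.-tuple (point Pi), poncelet_polygon Ot Os t.

Definition poncelet_pair Ot Os (m : nat) : Prop :=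
  has_poncelet_polygon Ot Os m /\
  forall m' : nat, (3 <= m' <= n.+1)%N -> m' <> m ->
    ~ has_poncelet_polygon Ot Os m'.

Definition poncelet_zero_pair Ot Os : Prop :=
  forall l, secant Os l -> ~~ tangent Ot l.

Definition poncelet_infty_pair Ot Os : Prop :=
  (exists2 l, secant Os l & tangent Ot l) /\
  forall m : nat, (3 <= m <= n.+1)%N -> ~ has_poncelet_polygon Ot Os m.

Definition poncelet_plane : Prop :=
  forall Ot Os, oval Ot -> oval Os ->
    [\/ exists2 m : nat, (3 <= m <= n.+1)%N & poncelet_pair Ot Os m,
        poncelet_zero_pair Ot Os
      | poncelet_infty_pair Ot Os].

End Poncelet.

(* The miniquaternion near-field: [(a, b)] is the element a + b i of GF(9),
   where i^2 = -1, and the near-field product x y is the field product when y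
   is a square of GF(9) (lemma [gf9_squareP]), and x^3 y otherwise. Addition is
   the componentwise one of ['F_3 * 'F_3]; the componentwise ring product (and
   its unit) is not used. *)
Notation miniq := ('F_3 * 'F_3)%type.

Definition mq1 : miniq := (1, 0).

Definition gf9_mul (x y : miniq) : miniq :=
  (x.1 * y.1 - x.2 * y.2, x.1 * y.2 + x.2 * y.1).

Definition gf9_square (y : miniq) : bool := y.1 * y.2 == 0.

Definition mq_mul (x y : miniq) : miniq :=
  if gf9_square y then gf9_mul x y else gf9_mul (gf9_mul x (gf9_mul x x)) y.

Notation mq3 := (miniq * miniq * miniq)%type.

Definition scale3 (v : mq3) (k : miniq) : mq3 :=
  let: (x, y, z) := v in (mq_mul x k, mq_mul y k, mq_mul z k).

(* Points are nonzero triples up to right multiplication by nonzero scalars;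
   each class is represented by its unique triple whose last nonzero
   coordinate is 1 (lemma [hughes_point_rep]). *)
Definition normalized (v : mq3) : bool :=
  let: (x, y, z) := v in
  [|| z == mq1, (z == 0) && (y == mq1) | [&& z == 0, y == 0 & x == mq1]].

Notation hughes_point := {v : mq3 | normalized v}.

(* A matrix of SL_3(3) of order 13, with characteristic polynomial X^3 - X - 1;
   its powers permute the 13 points over GF(3) cyclically. *)
Definition singer (v : mq3) : mq3 := let: (x, y, z) := v in (z, x + z, y).

(* Hughes' base lines x + t y + z = 0 are taken for t = 1 and for the six t
   outside the central subfield GF(3). *)
Definition line_parameter (t : miniq) : bool := (t == mq1) || (t.2 != 0).

Definition base_line (t : miniq) (v : mq3) : bool :=
  let: (x, y, z) := v in x + mq_mul t y + z == 0.

(* [(m, t)] is the image of the base line of t under the power -m of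
   [singer]. *)
Notation hughes_line := ('I_13 * {t : miniq | line_parameter t})%type.

Definition hughes_inc (p : hughes_point) (l : hughes_line) : bool :=
  base_line (val l.2) (iter l.1 singer (val p)).

Definition F3s : seq 'F_3 := [:: 0; 1; -1].
Definition mqs : seq miniq := [seq (a, b) | a <- F3s, b <- F3s].
Definition mq3s : seq mq3 :=
  [seq (xy, z) | xy <- [seq (x, y) | x <- mqs, y <- mqs], z <- mqs].

Lemma F3s_mem (a : 'F_3) : a \in F3s.
Proof. by case: a => [[|[|[|?]]] ?]; rewrite //= !inE -!val_eqE. Qed.

Lemma mqs_mem (x : miniq) : x \in mqs.
Proof. by case: x => a b; apply/allpairsP; exists (a, b); rewrite !F3s_mem. Qed.

Lemma mq3s_mem (v : mq3) : v \in mq3s.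
Proof.
case: v => [[x y] z]; apply/allpairsP; exists ((x, y), z).
split; rewrite ?mqs_mem //; apply/allpairsP; exists (x, y).
by rewrite !mqs_mem.
Qed.

Lemma mq_all (P : pred miniq) : all P mqs -> forall x, P x.
Proof. by move/allP=> PP x; apply/PP/mqs_mem. Qed.

Lemma mq3_all (P : pred mq3) : all P mq3s -> forall v, P v.
Proof. by move/allP=> PP v; apply/PP/mq3s_mem. Qed.

Lemma gf9_squareP (y : miniq) :
  reflect (exists z, y = gf9_mul z z) (gf9_square y).
Proof.
have H : gf9_square y == has (fun z => y == gf9_mul z z) mqs.
  by move: y; apply: mq_all; vm_compute.
rewrite (eqP H); apply: (iffP hasP) => [[z _ /eqP ->]|[z ->]]; first by exists z.
by exists z; rewrite ?mqs_mem.
Qed.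

Lemma mq_mulA (x y z : miniq) : mq_mul (mq_mul x y) z = mq_mul x (mq_mul y z).
Proof.
apply/eqP; move: z; apply: mq_all; move: y; apply: mq_all; move: x.
by apply: mq_all; vm_compute.
Qed.

Lemma mq_mulDl (x y z : miniq) : mq_mul (x + y) z = mq_mul x z + mq_mul y z.
Proof.
apply/eqP; move: z; apply: mq_all; move: y; apply: mq_all; move: x.
by apply: mq_all; vm_compute.
Qed.

Lemma mq_mul1 (x : miniq) : mq_mul x mq1 = x.
Proof. by apply/eqP; move: x; apply: mq_all; vm_compute. Qed.

Lemma mq_inv (k : miniq) : k != 0 -> exists2 j, j != 0 & mq_mul k j = mq1.
Proof.
have H : (k != 0) ==> has (fun j => (j != 0) && (mq_mul k j == mq1)) mqs.
  by move: k; apply: mq_all; vm_compute.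
by move=> k0; have /hasP[j _ /andP[j0 /eqP kj]] := implyP H k0; exists j.
Qed.

Lemma scale3A v j k : scale3 (scale3 v j) k = scale3 v (mq_mul j k).
Proof. by case: v => [[x y] z]; rewrite /scale3 !mq_mulA. Qed.

Lemma scale31 v : scale3 v mq1 = v.
Proof. by case: v => [[x y] z]; rewrite /scale3 !mq_mul1. Qed.

Lemma normalized_scale v k :
  normalized v -> normalized (scale3 v k) -> k = mq1.
Proof.
have : all (fun v => all (fun k => normalized (scale3 v k) ==> (k == mq1)) mqs)
    [seq v <- mq3s | normalized v].
  by vm_compute.
rewrite all_filter => /mq3_all /(_ v) /implyP H /H /mq_all /(_ k) /implyP {}H /H.
by move/eqP.
Qed.

Lemma hughes_point_rep (v : mq3) : v != 0 ->
  exists! p : hughes_point, exists2 k : miniq, k != 0 & v = scale3 (val p) k.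
Proof.
have H : (v != 0) ==>
    has (fun k : miniq => (k != 0) && normalized (scale3 v k)) mqs.
  by move: v; apply: mq3_all; vm_compute.
move=> v0; have /hasP[k _ /andP[k0 nk]] := implyP H v0.
exists (exist (fun v => normalized v) _ nk); split=> [|[q nq] [j j0 /= vE]].
  have [k' k'0 kk'] := mq_inv k0; exists k' => //=.
  by rewrite scale3A kk' scale31.
apply: val_inj; rewrite /= vE scale3A (normalized_scale (k := mq_mul j k) nq).
  by rewrite scale31.
by rewrite -scale3A -vE.
Qed.

Definition point_coords := [seq v <- mq3s | normalized v].
Definition line_coords : seq (nat * miniq) :=
  [seq (m, t) | m <- iota 0 13, t <- [seq t <- mqs | line_parameter t]].
Definition inc_coords (v : mq3) (l : nat * miniq) := base_line l.2 (iter l.1 singer v).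
Definition line_coord (l : hughes_line) : nat * miniq := (val l.1, val l.2).

Definition hughes_points : seq hughes_point := pmap insub point_coords.
Definition hughes_lines : seq hughes_line :=
  [seq (m, t) | m <- enum 'I_13, t <- pmap insub mqs].

Lemma mqs_uniq : uniq mqs. Proof. by vm_compute. Qed.

Lemma pts_val : map val hughes_points = point_coords.
Proof.
rewrite /hughes_points pmap_filter ?filter_id //; last exact: insubK.
by apply/all_filterP; apply/allP => v; rewrite mem_filter isSome_insub => /andP[].
Qed.

Lemma pts_uniq : uniq hughes_points.
Proof.
rewrite -(map_inj_uniq val_inj) pts_val; apply: filter_uniq.
apply: allpairs_uniq _ mqs_uniq _; last by move=> [x z] [y t] _ _ [-> ->].
by apply: allpairs_uniq mqs_uniq mqs_uniq _ => -[x z] [y t] _ _ [-> ->].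
Qed.

Lemma pts_mem p : p \in hughes_points.
Proof.
by rewrite -(mem_map val_inj) pts_val mem_filter mq3s_mem (valP p).
Qed.

Lemma lines_val : map line_coord hughes_lines = line_coords.
Proof.
rewrite /hughes_lines map_allpairs /line_coords -val_enum_ord allpairs_mapl.
have -> : [seq t <- mqs | line_parameter t]
    = map val (pmap insub mqs : seq {t : miniq | line_parameter t}).
  rewrite pmap_filter; last exact: insubK.
  by apply: eq_filter => t; rewrite isSome_insub.
by rewrite allpairs_mapr.
Qed.

Lemma line_coord_inj : injective line_coord.
Proof. by move=> [m t] [m' t'] [] /val_inj -> /val_inj ->. Qed.

Lemma lines_uniq : uniq hughes_lines.
Proof. by rewrite -(map_inj_uniq line_coord_inj) lines_val; vm_compute. Qed.

Lemma lines_mem l : l \in hughes_lines.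
Proof.
case: l => m t; apply/allpairsP; exists (m, t).
by split; rewrite ?mem_enum // mem_pmap_sub mqs_mem.
Qed.

Definition common (r s : seq bool) := count (fun ab => ab.1 && ab.2) (zip r s) == 1%N.

Lemma commonE (T : Type) (f g : T -> bool) s :
  common (map f s) (map g s) = (count (fun x => f x && g x) s == 1%N).
Proof. by congr (_ == _); elim: s => //= x s ->. Qed.

Lemma commonC r s : common r s = common s r.
Proof.
by congr (_ == _); elim: r s => [[]|a r IH []] //= b s; rewrite IH andbC.
Qed.

Lemma pairwise_ex1 (S T : eqType) (I : S -> T -> bool) (s : seq S) (t : seq T) :
  (forall x, x \in s) -> (forall y, y \in t) -> uniq t ->
  pairwise common [seq [seq I x y | y <- t] | x <- s] ->
  forall x x', x != x' -> exists! y, I x y && I x' y.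
Proof.
move=> s_mem t_mem t_uniq; rewrite pairwise_map => pw x x' xx'.
have: count (fun y => I x y && I x' y) t == 1%N.
  rewrite -commonE; move/(pairwiseP x): pw => pw.
  have xs : (index x s < size s)%N by rewrite index_mem.
  have xs' : (index x' s < size s)%N by rewrite index_mem.
  case: (ltngtP (index x s) (index x' s)) => [lt|lt|eq].
  - by have := pw _ _ xs xs' lt; rewrite /= !nth_index.
  - by have := pw _ _ xs' xs lt; rewrite /= !nth_index // commonC.
  - by move: xx'; rewrite -(nth_index x (s_mem x)) eq nth_index // eqxx.
rewrite -size_filter; set u := filter _ _ => u1.
have uP y : (I x y && I x' y) = (y \in u) by rewrite mem_filter t_mem andbT.
case: u uP u1 => [|y []] // uP _; exists y; split=> [|z].
  by rewrite uP inE.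
by rewrite uP inE => /eqP.
Qed.

Lemma hughes_join p q : p != q -> exists! l, hughes_inc p l && hughes_inc q l.
Proof.
apply: (pairwise_ex1 pts_mem lines_mem lines_uniq).
have -> : [seq [seq hughes_inc x y | y <- hughes_lines] | x <- hughes_points]
        = [seq [seq inc_coords v l | l <- line_coords] | v <- point_coords].
  rewrite -pts_val -lines_val -map_comp; apply: eq_map => x.
  by rewrite /= -map_comp.
by vm_compute.
Qed.

Lemma hughes_meet l k : l != k -> exists! p, hughes_inc p l && hughes_inc p k.
Proof.
apply: (pairwise_ex1 (I := fun l p => hughes_inc p l) lines_mem pts_mem pts_uniq).
have -> : [seq [seq hughes_inc p l | p <- hughes_points] | l <- hughes_lines]
        = [seq [seq inc_coords v l | v <- point_coords] | l <- line_coords].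
  rewrite -pts_val -lines_val -map_comp; apply: eq_map => x.
  by rewrite /= -map_comp.
by vm_compute.
Qed.

Lemma card_inc (P : pred mq3) l :
  #|[set p : hughes_point | P (val p) && hughes_inc p l]|
  = count (fun v => P v && inc_coords v (line_coord l)) point_coords.
Proof.
rewrite -pts_val count_map -size_filter -(card_uniqP _); last first.
  exact/filter_uniq/pts_uniq.
by apply: eq_card => p; rewrite inE mem_filter pts_mem andbT.
Qed.

Lemma lines_all (P : pred (nat * miniq)) : all P line_coords -> forall l, P (line_coord l).
Proof. by rewrite -lines_val all_map => /allP H l; apply/H/lines_mem. Qed.

Lemma hughes_line_card l : #|[set p | hughes_inc p l]| = 10%N.
Proof.
rewrite (card_inc xpredT); apply/eqP.
by move: l; apply: (lines_all (P := fun l => count (inc_coords^~ l) point_coords == 10%N)); vm_compute.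
Qed.

Lemma hughes_quadrangle : exists2 Q : {set hughes_point},
  #|Q| = 4%N & forall l, (#|[set p in Q | hughes_inc p l]| <= 2)%N.
Proof.
pose Q4 : seq mq3 := [:: (mq1, 0, 0); (0, mq1, 0); (0, 0, mq1); (mq1, mq1, mq1)].
exists [set p | val p \in Q4].
  transitivity (count (mem Q4) point_coords); last by vm_compute.
  rewrite -pts_val count_map -size_filter -(card_uniqP _) ?filter_uniq ?pts_uniq //.
  by apply: eq_card => p; rewrite inE mem_filter pts_mem andbT.
move=> l; have -> : [set p in [set p : hughes_point | val p \in Q4] | hughes_inc p l]
    = [set p | (val p \in Q4) && hughes_inc p l].
  by apply/setP => p; rewrite !inE.
rewrite (card_inc (mem Q4)); move: l.
apply: (lines_all (P := fun l =>
  count (fun v => (v \in Q4) && inc_coords v l) point_coords <= 2)%N).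
by vm_compute.
Qed.

Definition hughes_plane9 : projPlane 9 :=
  ProjPlane hughes_join hughes_meet hughes_quadrangle hughes_line_card.

(* Main.v *)
Require Import Defs.
From mathcomp Require Import all_boot all_order all_algebra.
Set Implicit Arguments.
Unset Strict Implicit.
Unset Printing Implicit Defensive.

Import GRing.Theory.
Local Open Scope ring_scope.

(* The plane contains two ovals such that the tangents of the first, joining
   points of the second, form a quadrilateral and a disjoint pentagon: a single
   pair of ovals has Poncelet polygons of two different sizes. The ovals were
   found by computer search. *)

Definition point_set (s : seq mq3) : {set point hughes_plane9} :=
  [set p : hughes_point | val p \in s].

(** A count over an explicit list, so that intersection numbers can be evaluated by [vm_compute];
    [card_on_line] links it to the plane. *)
Definition on_line (s : seq mq3) (l : nat * miniq) : nat :=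
  count (fun v => (v \in s) && inc_coords v l) point_coords.

Lemma card_on_line s (l : line hughes_plane9) :
  #|[set p in point_set s | inc p l]| = on_line s (line_coord l).
Proof.
rewrite -[RHS](card_inc (mem s)).
by apply: eq_card => p; rewrite !inE.
Qed.

Lemma card_point_set s : #|point_set s| = count (mem s) point_coords.
Proof.
rewrite -pts_val count_map -size_filter -(card_uniqP _) ?filter_uniq ?pts_uniq //.
by apply: eq_card => p; rewrite inE mem_filter pts_mem andbT.
Qed.

Lemma exists_line (P : pred (nat * miniq)) :
  has P line_coords -> exists l : line hughes_plane9, P (line_coord l).
Proof. by rewrite -lines_val has_map => /hasP[l _ Pl]; exists l. Qed.

(** Three distinct collinear points of [O] would put three points of [O] on one line. The oval
    condition thus becomes one check per line instead of one per triple of points. *)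
Lemma oval_of_lines n (Pi : projPlane n) (O : {set point Pi}) :
  #|O| = n.+1 -> (forall l, #|[set p in O | inc p l]| <= 2)%N -> oval O.
Proof.
move=> cardO O2; split=> // p q r pO qO rO pq pr qr.
apply/existsP => -[l /and3P[pl ql rl]].
have := O2 l; rewrite leqNgt => /negP; apply.
have /card_uniqP pqr3 : uniq [:: p; q; r] by rewrite /= !inE negb_or pq pr qr.
apply: (@leq_trans #|[:: p; q; r]|); first by rewrite pqr3.
apply/subset_leq_card/subsetP => x; rewrite !inE.
by case/or3P=> /eqP->; apply/andP.
Qed.

Lemma oval_point_set s :
  count (mem s) point_coords = 10%N ->
  all (fun l => on_line s l <= 2)%N line_coords -> oval (point_set s).
Proof.
move=> s10 /lines_all s2; apply: oval_of_lines; first by rewrite card_point_set.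
by move=> l; rewrite card_on_line; apply: s2.
Qed.

Definition tangent_coords (s : seq mq3) (u v : mq3) : bool :=
  has (fun l => [&& inc_coords u l, inc_coords v l & on_line s l == 1%N]) line_coords.

Lemma polygon_coords (st ss vs : seq mq3) :
  all normalized vs -> uniq vs -> all (mem ss) vs ->
  cycle (tangent_coords st) vs ->
  has_poncelet_polygon (point_set st) (point_set ss) (size vs).
Proof.
move=> vs_norm vs_uniq /allP vs_ss vs_cycle.
pose t : seq hughes_point := pmap insub vs.
(* [pmap insub] drops triples that are not normalized; by [vs_norm] no vertex is lost. *)
have tE : map val t = vs.
  rewrite pmap_filter; last exact: insubK.
  by rewrite (eq_filter (isSome_insub _)) (all_filterP vs_norm).
have t_size : size t == size vs by rewrite -tE size_map.
exists (Tuple t_size); split => /=.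
- by rewrite -(map_inj_uniq val_inj) tE.
- by move=> p tp; rewrite inE; apply: vs_ss; rewrite -tE map_f.
move: vs_cycle; rewrite -tE cycle_map; apply: sub_cycle => p q /exists_line[l].
by rewrite -card_on_line => pql; apply/existsP; exists l.
Qed.

(** The point (a + b i, c + d i, 1), off the line z = 0. *)
Definition affine_point (c : 'F_3 * 'F_3 * 'F_3 * 'F_3) : mq3 :=
  let: (a, b, c, d) := c in ((a, b), (c, d), mq1).

Definition tangent_oval : seq mq3 := map affine_point
  [:: (0, 0, 1, -1); (0, 0, -1, 1); (-1, 1, 1, 0); (0, 1, 1, 1); (-1, 1, -1, -1);
      (0, 1, -1, 0); (1, -1, 1, 0); (0, -1, 1, 1); (0, -1, -1, 0); (1, -1, -1, -1)].

(** The order matters here and in [pentagon]: cyclically consecutive points are joined by tangents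
    of [tangent_oval]. *)
Definition quadrilateral : seq mq3 := map affine_point
  [:: (1, 0, 1, -1); (0, 1, 1, -1); (1, -1, 0, 0); (-1, 1, 0, -1)].

Definition pentagon : seq mq3 := map affine_point
  [:: (-1, 1, 0, 0); (-1, -1, -1, 1); (0, 1, -1, 1); (-1, -1, 0, 1); (1, -1, 0, -1)].

(** The first point is a vertex of neither polygon; it brings the nine vertices up to the ten points
    of an oval. *)
Definition secant_oval : seq mq3 :=
  affine_point (1, 0, 0, 1) :: quadrilateral ++ pentagon.

Lemma tangent_ovalP : oval (point_set tangent_oval).
Proof. by apply: oval_point_set; vm_compute. Qed.

Lemma secant_ovalP : oval (point_set secant_oval).
Proof. by apply: oval_point_set; vm_compute. Qed.

Lemma has_quadrilateral :
  has_poncelet_polygon (point_set tangent_oval) (point_set secant_oval) 4.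
Proof. by apply: (@polygon_coords _ _ quadrilateral); vm_compute. Qed.

Lemma has_pentagon :
  has_poncelet_polygon (point_set tangent_oval) (point_set secant_oval) 5.
Proof. by apply: (@polygon_coords _ _ pentagon); vm_compute. Qed.

(** Rules out a Poncelet 0-pair. Any side of the quadrilateral is such a line; a search over all
    lines finds one. *)
Lemma tangent_secant : exists l : line hughes_plane9,
  secant (point_set secant_oval) l && tangent (point_set tangent_oval) l.
Proof.
have /exists_line[l] :
    has (fun l => (on_line secant_oval l == 2%N) && (on_line tangent_oval l == 1%N))
      line_coords by vm_compute.
by rewrite -!card_on_line; exists l.
Qed.

Theorem theorem12 : ~ poncelet_plane hughes_plane9.
Proof.
move=> /(_ _ _ tangent_ovalP secant_ovalP) [[m _ [_ m_only]]|zero|[_ none]].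
(* A single size [m] cannot be both 4 and 5: the pentagon refutes [m = 4], the quadrilateral any
   other [m]. *)
- have [m4|/eqP m4] := eqVneq m 4%N.
    by apply: (m_only 5%N) has_pentagon => //; rewrite m4.
  by apply: (m_only 4%N) has_quadrilateral => // /esym.
- by have [l /andP[/zero/negP]] := tangent_secant.
- exact: none has_quadrilateral.
Qed.
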